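(* Any (real) Banach space $X$ that is separable or reflexive has enough Pettis integrals, and hence is an $\mathbb{M}$-algebra when endowed with the norm bornology, the weak sigma-algebra, and the structure map $c:MX\to X$ sending each $\mu\in MX$ to the Pettis integral of the identity map $\mathrm{id}_X:X\to X$ with respect to $\mu$.
   Context: Pettis integrals. For a real Banach space $X$, $X^*$ is the space of bounded linear functionals on $X$; the weak sigma-algebra on $X$ is the one generated by all $\varphi\in X^*$; the norm bornology consists of the norm-bounded subsets. For a measurable space $T$, $f:T\to X$ is weakly measurable if $\varphi\circ f$ is measurable for all $\varphi\in X^*$. Given a weakly measurable $f:T\to X$ and a finite signed measure $\mu$ on $T$, a vector $x\in X$ is a Pettis integral of $f$ with respect to $\mu$ if for all $\varphi\in X^*$, $\varphi\circ f$ is $\mu$-integrable (i.e. integrable with respect to $|\mu|$) and $\varphi(x)=\int\varphi\circ f\,d\mu$; it is unique if it exists. $X$ has enough Pettis integrals if for every measurable space $T$, every weakly measurable $f:T\to X$ with bounded image, and every finite signed measure $\mu$ on $T$, a Pettis integral of $f$ with respect to $\mu$ exists in $X$. A bornology on a set $X$ is a collection of subsets of $X$ (the bounded subsets) closed under taking subsets and finite unions (in particular containing $\emptyset$) and containing all singletons. A measurable bornological set is a set equipped with both a bornology and a sigma-algebra; $\mathbf{BornMeas}$ is the category of these with maps that are measurable and bornological (images of bounded sets are bounded). $\mathbb{R}$ carries its Borel sigma-algebra and usual bornology. A subset $A\subseteq X$ carries the sigma-algebra $\{A\cap E\mid E\subseteq X\text{ measurable}\}$ and the bornology of those subsets of $A$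 bounded in $X$. For a measurable space $X$, $SX$ is the real vector space of all finite signed measures on $X$, with the sigma-algebra generated by the evaluation maps $\mathrm{Ev}_E:\mu\mapsto\mu(E)$ ($E$ measurable) and the total variation norm $\|\mu\|=|\mu|(X)$. For $f:X\to Y$ measurable, $Sf(\mu)$ is the direct image measure $F\mapsto\mu(f^{-1}(F))$. $\mu\in SX$ is supported by an arbitrary subset $A\subseteq X$ if it is the direct image, along the inclusion $A\hookrightarrow X$, of some measure in $SA$. The monad $\mathbb{M}=(M,\delta,\kappa)$ on $\mathbf{BornMeas}$: $MX$ is the set of all $\mu\in SX$ supported by some bounded $B\subseteq X$, with sigma-algebra generated by the maps $\mathrm{Ev}_E:MX\to\mathbb{R}$ and bornology consisting of all subsets of the sets $M(B,X,\gamma)=\{\mu\in MX\mid\mu\text{ supported by }B,\ \|\mu\|\leqslant\gamma\}$ ($B\subseteq X$ bounded, $\gamma\geqslant0$); $Mf$ is the restriction of $Sf$; $\delta_X(x)=\delta_x$ is the Dirac measure; $(\kappa_X(\mathcal{M}))(E)=\int\mathrm{Ev}_E\,d\mathcal{M}$ for $\mathcal{M}\in MMX$. An $\mathbb{M}$-algebra is $X\in\mathbf{BornMeas}$ with a $\mathbf{BornMeas}$-morphism $c:MX\to X$ such that $c\circ\delta_X=1_X$ and $c\circ Mc=c\circ\kappa_X$. *)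

(* Defs.v *)
From HB Require Import structures.
From mathcomp Require Import all_boot all_order all_algebra.
From mathcomp Require Import all_classical all_reals all_analysis.
From mathcomp Require Import measurable_realfun.

Set Implicit Arguments.
Unset Strict Implicit.
Unset Printing Implicit Defensive.

Import Order.TTheory GRing.Theory Num.Def Num.Theory.
Import numFieldNormedType.Exports.

Local Open Scope classical_set_scope.
Local Open Scope ring_scope.

Section dual.
Context {R : realType} (X : normedModType R).

Definition bounded_functional : {pred X -> R^o} :=
  mem [set phi : X -> R^o |
    linear phi /\ exists C : R, forall x, `|phi x| <= C * `|x|].

Record dual_space : Type := DualSpace {
  dual_fun :> X -> R^o ;
  _ : dual_fun \in bounded_functional }.

HB.instance Definition _ := [isSub for dual_fun].
HB.instance Definition _ := [Choice of dual_space by <:].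

Lemma bounded_functional_submod_closed : submod_closed bounded_functional.
Proof.
split=> [|a f g].
  rewrite inE/=; split; first by move=> a x y; rewrite scaler0 addr0.
  by exists 0 => x; rewrite normr0 mul0r.
rewrite !inE/= => -[lf [C fC]] [lg [D gD]]; split.
  move=> b x y; rewrite /GRing.add/= /GRing.scale/= lf lg.
  rewrite /GRing.scale/= !mulrDr addrACA; congr (_ + _).
  by congr (_ + _); rewrite mulrCA.
exists (`|a| * C + D) => x; rewrite (le_trans (ler_normD _ _))// mulrDl.
by rewrite lerD// normrZ -mulrA ler_wpM2l.
Qed.

HB.instance Definition _ :=
  GRing.isSubmodClosed.Build _ _ bounded_functional
    bounded_functional_submod_closed.
HB.instance Definition _ := [SubChoice_isSubLmodule of dual_space by <:].

Lemma dual_linear (phi : dual_space) : linear phi.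
Proof. by case: phi => f /=; rewrite inE => -[]. Qed.

Lemma dual_bounded (phi : dual_space) : exists C : R, forall x, `|phi x| <= C * `|x|.
Proof. by case: phi => f /=; rewrite inE => -[]. Qed.

HB.instance Definition _ (phi : dual_space) :=
  GRing.isLinear.Build R X R^o _ phi (dual_linear phi).

Definition dual_norm (phi : dual_space) : R :=
  sup [set `|phi x| | x in [set x : X | `|x| <= 1]].

Lemma dual_has_sup (phi : dual_space) :
  has_sup [set `|phi x| | x in [set x : X | `|x| <= 1]].
Proof.
split; first by exists `|phi 0|, 0 => //=; rewrite normr0 ler01.
have [C phiC] := dual_bounded phi.
exists `|C| => _ [x /= x1 <-]; rewrite (le_trans (phiC x))//.
by rewrite (le_trans (ler_norm _))// normrM normr_id ler_piMr.
Qed.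

Lemma dual_norm_ub (phi : dual_space) x : `|x| <= 1 -> `|phi x| <= dual_norm phi.
Proof.
by move=> x1; apply: sup_ubound; [have [] := dual_has_sup phi|exists x].
Qed.

Lemma dual_norm_le (phi : dual_space) C :
  (forall x, `|x| <= 1 -> `|phi x| <= C) -> dual_norm phi <= C.
Proof.
move=> phiC; apply: ge_sup; first by have [] := dual_has_sup phi.
by move=> _ [x /= x1 <-]; exact: phiC.
Qed.

Lemma dual_norm_ge0 (phi : dual_space) : 0 <= dual_norm phi.
Proof.
by apply: le_trans (dual_norm_ub phi (x := 0) _); rewrite ?normr0 ?ler01.
Qed.

Lemma dual_normP (phi : dual_space) x : `|phi x| <= dual_norm phi * `|x|.
Proof.
have [->|x0] := eqVneq x 0; first by rewrite linear0 !normr0 mulr0.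
have nx0 : 0 < `|x| by rewrite normr_gt0.
rewrite -ler_pdivrMr//.
have -> : `|phi x| / `|x| = `|phi (`|x|^-1 *: x)|.
  by rewrite linearZ/= normrZ mulrC normfV normr_id.
by apply: dual_norm_ub; rewrite normrZ normfV normr_id mulVf// gt_eqF.
Qed.

Lemma dual_ler_normD (phi psi : dual_space) :
  dual_norm (phi + psi) <= dual_norm phi + dual_norm psi.
Proof.
apply: dual_norm_le => x x1; rewrite (le_trans (ler_normD _ _))//.
by rewrite lerD// dual_norm_ub.
Qed.

Lemma dual_normrZ (a : R) (phi : dual_space) :
  dual_norm (a *: phi) = `|a| * dual_norm phi.
Proof.
apply/eqP; rewrite eq_le; apply/andP; split.
  apply: dual_norm_le => x x1; rewrite [X in `|X|]/=.
  by rewrite -[X in `|X| <= _]/(a *: phi x) normrZ ler_wpM2l// dual_norm_ub.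
have [->|a0] := eqVneq a 0; first by rewrite normr0 mul0r dual_norm_ge0.
have na0 : 0 < `|a| by rewrite normr_gt0.
rewrite mulrC -ler_pdivlMr//; apply: dual_norm_le => x x1.
rewrite ler_pdivlMr// mulrC -normrZ.
exact: (dual_norm_ub (a *: phi)).
Qed.

Lemma dual_normr0_eq0 (phi : dual_space) : dual_norm phi = 0 -> phi = 0.
Proof.
move=> phi0; apply/val_inj/funext => x /=.
by apply/eqP; rewrite -normr_le0 (le_trans (dual_normP phi x))// phi0 mul0r.
Qed.

HB.instance Definition _ := Lmodule_isNormed.Build R dual_space
  dual_ler_normD dual_normrZ dual_normr0_eq0.

End dual.
Arguments bounded_functional {R} X.

Section reflexive.
Context {R : realType} (X : normedModType R).

Definition evaluation (x : X) : dual_space X -> R^o := fun phi => phi x.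

Lemma evaluation_bounded (x : X) :
  evaluation x \in bounded_functional (dual_space X).
Proof.
rewrite inE/=; split=> // ; exists `|x| => phi.
by rewrite mulrC; exact: dual_normP.
Qed.

Definition to_bidual (x : X) : dual_space (dual_space X) :=
  DualSpace (evaluation_bounded x).

Definition reflexive_space : Prop := range to_bidual = setT.

End reflexive.

Definition separable (T : topologicalType) : Prop :=
  exists2 D : set T, countable D & dense D.

Section signed_measures.
Context d {T : measurableType d} {R : realType}.
Implicit Type mu : {charge set T -> \bar R}.

(* Finite signed measures are the library's charges.  The library's Jordan
   decomposition and variation depend on a Hahn decomposition, which is chosen
   here once and for all; neither depends on that choice. *)
Definition hahn_pos mu : set T := sval (cid (Hahn_decomposition mu)).

Definition hahn_neg mu : set T :=
  sval (cid (svalP (cid (Hahn_decomposition mu)))).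

Definition hahnP mu : hahn_decomposition mu (hahn_pos mu) (hahn_neg mu) :=
  svalP (cid (svalP (cid (Hahn_decomposition mu)))).

Definition positive_part mu := jordan_pos (hahnP mu).

Definition negative_part mu := jordan_neg (hahnP mu).

Definition variation mu := charge_variation (hahnP mu).

HB.instance Definition _ mu := Measure.on (positive_part mu).
HB.instance Definition _ mu := FiniteMeasure.on (positive_part mu).
HB.instance Definition _ mu := Measure.on (negative_part mu).
HB.instance Definition _ mu := FiniteMeasure.on (negative_part mu).
HB.instance Definition _ mu := Measure.on (variation mu).

Definition variation_norm mu : R := fine (variation mu setT).

Definition charge_integrable mu (f : T -> R) : Prop :=
  (variation mu).-integrable setT (EFin \o f).

Definition charge_integral mu (f : T -> R) : R :=
  \int[positive_part mu]_x f x - \int[negative_part mu]_x f x.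

End signed_measures.

Section supported.

(* A finite signed measure on a bare set with a sigma-algebra G.  It is only used
   for subspaces A of a measurable space, where A may be empty, whereas the
   library's measurable types are pointed. *)
Definition is_signed_measure (S : Type) {R : realType} (G : set (set S))
    (nu : set S -> \bar R) : Prop :=
  [/\ nu set0 = 0%E,
      forall C, G C -> nu C \is a fin_num &
      forall F : (set S)^nat, (forall n, G (F n)) -> trivIset setT F ->
        (fun n => \sum_(0 <= i < n) nu (F i))%E @ \oo --> nu (\bigcup_n F n)].

Context d {T : measurableType d} {R : realType}.

Definition trace_sigma_algebra (A : set T) : set (set A) :=
  [set (val : A -> T) @^-1` E | E in measurable].

Arguments trace_sigma_algebra : clear implicits.

Definition supported (mu : {charge set T -> \bar R}) (A : set T) : Prop :=
  exists2 nu : set A -> \bar R,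
    is_signed_measure (trace_sigma_algebra A) nu &
    forall E, measurable E -> mu E = nu ((val : A -> T) @^-1` E).

Lemma trace_eqP (A E E' : set T) :
  (val : A -> T) @^-1` E = val @^-1` E' -> E `&` A = E' `&` A.
Proof.
move=> EE'; apply/seteqP; split=> x [Ex Ax]; split=> //.
  have : ((val : A -> T) @^-1` E) (SigSub (mem_set Ax)) by [].
  by rewrite EE'.
have : ((val : A -> T) @^-1` E') (SigSub (mem_set Ax)) by [].
by rewrite -EE'.
Qed.

Lemma supportedP (mu : {charge set T -> \bar R}) (A : set T) :
  supported mu A <->
  forall E, measurable E -> E `&` A = set0 -> mu E = 0%E.
Proof.
split=> [[nu [nu0 _ _] munu] E mE EA|mu0].
  rewrite munu// -nu0; congr nu; apply/seteqP; split=> // -[x Ax] /= Ex.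
  suff : (E `&` A) x by rewrite EA.
  by split=> //; exact: set_mem.
have mutr E E' : measurable E -> measurable E' -> E `&` A = E' `&` A ->
    mu E = mu E'.
  move=> mE mE' EE'.
  rewrite (chargeDI mu mE mE') (chargeDI mu mE' mE) (setIC E') .
  congr (_ + _)%E; rewrite !mu0 //; try exact: measurableD.
  - apply/seteqP; split=> // x [[E'x nEx] Ax].
    by have [] : (E `&` A) x by rewrite EE'.
  - apply/seteqP; split=> // x [[Ex nE'x] Ax].
    by have [] : (E' `&` A) x by rewrite -EE'.
pose P (C : set A) := [set E : set T | measurable E /\ val @^-1` E = C].
pose nu (C : set A) := mu (xget set0 (P C)).
have nuE E : measurable E -> nu ((val : A -> T) @^-1` E) = mu E.
  move=> mE; rewrite /nu; case: xgetP => [E' _ [mE' /trace_eqP EE']|nP].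
    exact: mutr.
  by exfalso; apply: (nP E).
exists nu => [|E mE]; last by rewrite nuE.
split.
- by have := nuE set0 measurable0; rewrite preimage_set0 charge0.
- by move=> _ [E mE <-]; rewrite nuE// fin_num_measure.
move=> F FT tF.
have /choice[E EP] : forall n, exists E, measurable E /\ val @^-1` E = F n.
  by move=> n; have [E mE EF] := FT n; exists E.
have mE n : measurable (E n) by have [] := EP n.
have mH n : measurable (seqDU E n).
  by apply: measurableD => //; exact: bigsetU_measurable.
have EH n : (val : A -> T) @^-1` (seqDU E n) = F n.
  have [_ EF] := EP n; apply/seteqP; split=> [x [Ex _]|x Fx].
    by rewrite -EF.
  split; first by rewrite -EF in Fx.
  rewrite -bigcup_mkord => -[k /= kn Ekx].
  have [_ EFk] := EP k.
  have Fkx : F k x by rewrite -EFk.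
  by have kn' : k = n; [apply: tF => //; exists x|rewrite kn' ltnn in kn].
have -> : \bigcup_n F n = (val : A -> T) @^-1` (\bigcup_n seqDU E n).
  by rewrite preimage_bigcup; apply: eq_bigcupr => n _; rewrite EH.
rewrite nuE; last exact: bigcup_measurable.
rewrite (_ : (fun n => _) = fun n => (\sum_(0 <= i < n) mu (seqDU E i))%E).
  apply: charge_semi_sigma_additive => //; exact: bigcup_measurable.
by apply/funext => n; apply: eq_bigr => i _; rewrite -EH nuE.
Qed.

End supported.

(* Measurable types being pointed, bornMeasType omits the empty object; no
   M-algebra is empty, since M X always contains the zero measure. *)
HB.mixin Record isBornological T := {
  bornology : set (set T) ;
  bornology0 : bornology set0 ;
  bornology_sub : forall A B, A `<=` B -> bornology B -> bornology A ;
  bornologyU : forall A B, bornology A -> bornology B -> bornology (A `|` B) ;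
  bornology1 : forall x, bornology [set x]
}.

#[short(type="bornologicalType")]
HB.structure Definition Bornological := {T of isBornological T}.

#[short(type="bornMeasType")]
HB.structure Definition BornMeas d := {T of Measurable d T & Bornological T}.

Record bornMeasHom d d' (X : bornMeasType d) (Y : bornMeasType d') := BornMeasHom {
  hom_fun :> X -> Y ;
  hom_measurable : measurable_fun setT hom_fun ;
  hom_bornological : forall B, bornology B -> bornology (hom_fun @` B)
}.

Section monad_object.
Context (R : realType) d (X : bornMeasType d).

(* A charge is a function on all subsets; requiring it to vanish on the
   non-measurable ones makes two elements of M equal exactly when they agree on
   the measurable sets. *)
Record M := MkM {
  M_charge :> {charge set X -> \bar R} ;
  M_nonmeasurable : forall A, ~ measurable A -> M_charge A = 0%E ;
  M_supported : exists2 B, bornology B & supported M_charge B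
}.

HB.instance Definition _ := gen_eqMixin M.
HB.instance Definition _ := gen_choiceMixin M.

Section build.
Variable nu : {charge set X -> \bar R}.

(* nu on measurable sets and 0 on the others *)
Definition trunc : {charge set X -> \bar R} := crestr0 nu (@measurableT _ X).

Lemma truncE A : measurable A -> trunc A = nu A.
Proof. by move=> mA; rewrite /trunc/= /crestr0 mem_set// /crestr setIT. Qed.

Lemma trunc_nonmeasurable A : ~ measurable A -> trunc A = 0%E.
Proof. by move=> mA; rewrite /trunc/= /crestr0 memNset. Qed.

Hypothesis nuB : exists2 B, bornology B & supported nu B.

Lemma trunc_supported : exists2 B, bornology B & supported trunc B.
Proof.
have [B bB /supportedP nuB0] := nuB; exists B => //.
by apply/supportedP => E mE EB; rewrite truncE// nuB0.
Qed.

Definition M_of_charge : M := MkM trunc_nonmeasurable trunc_supported.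

Lemma M_of_chargeE A : measurable A -> M_of_charge A = nu A.
Proof. exact: truncE. Qed.

End build.

Lemma czero_supported : exists2 B : set X, bornology B & supported (@czero _ X R) B.
Proof. by exists set0; [exact: bornology0|exact/supportedP]. Qed.

HB.instance Definition _ := isPointed.Build M (M_of_charge czero_supported).

Definition Ev (E : set X) (mu : M) : R := fine (mu E).

Definition M_measurable : set (set M) :=
  <<s \bigcup_(E in measurable) preimage_set_system setT (Ev E) measurable >>.

Let M_measurableC (U : set M) : M_measurable U -> M_measurable (~` U).
Proof. by move=> mU; rewrite -setTD; exact: sigma_algebraCD. Qed.

Definition M_display : measure_display.
Proof. by constructor. Qed.

HB.instance Definition _ := @isMeasurable.Build M_display M M_measurable
  (@sigma_algebra0 _ _ _) M_measurableC (@sigma_algebra_bigcup _ _ _).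

Definition M_ball (B : set X) (gamma : R) : set M :=
  [set mu | supported mu B /\ variation_norm mu <= gamma].

Definition M_bornology : set (set M) :=
  [set S | exists B gamma, [/\ bornology B, 0 <= gamma & S `<=` M_ball B gamma]].

Lemma variation_norm_ge0 (mu : {charge set X -> \bar R}) : 0 <= variation_norm mu.
Proof. exact/fine_ge0/measure_ge0. Qed.

Lemma supported_sub (mu : {charge set X -> \bar R}) (A B : set X) :
  A `<=` B -> supported mu A -> supported mu B.
Proof.
move=> AB /supportedP muA; apply/supportedP => E mE EB; apply: muA => //.
by apply: subsetI_eq0 EB.
Qed.

Let M_bornology0 : M_bornology set0.
Proof. by exists set0, 0; split => //; exact: bornology0. Qed.

Let M_bornology_sub A B : A `<=` B -> M_bornology B -> M_bornology A.
Proof.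
move=> AB [C [g [bC g0 BC]]]; exists C, g; split=> //.
exact: subset_trans BC.
Qed.

Let M_bornologyU A B : M_bornology A -> M_bornology B -> M_bornology (A `|` B).
Proof.
move=> [C [g [bC g0 AC]]] [D [h [bD h0 BD]]].
exists (C `|` D), (g + h); split; [exact: bornologyU|exact: addr_ge0|].
move=> mu [/AC|/BD] [smu nmu]; split.
- exact: supported_sub smu.
- by rewrite (le_trans nmu)// lerDl.
- exact: supported_sub smu.
- by rewrite (le_trans nmu)// lerDr.
Qed.

Let M_bornology1 mu : M_bornology [set mu].
Proof.
have [B bB smu] := M_supported mu.
exists B, (variation_norm mu); split=> //; first exact: variation_norm_ge0.
by move=> _ ->; split.
Qed.

HB.instance Definition _ := isBornological.Build M
  M_bornology0 M_bornology_sub M_bornologyU M_bornology1.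

Lemma measurable_Ev (E : set X) : measurable E -> measurable_fun setT (Ev E).
Proof.
move=> mE _ Y mY; apply: sub_gen_smallest.
by exists E => //; exists Y.
Qed.

End monad_object.

Section dirac.
Context (R : realType) d (X : bornMeasType d) (x : X).

Definition dirac_charge : {charge set X -> \bar R} :=
  charge_of_finite_measure (@dirac _ X x R).

Lemma dirac_supported : exists2 B : set X, bornology B & supported dirac_charge B.
Proof.
exists [set x]; first exact: bornology1.
apply/supportedP => E mE Ex; rewrite /dirac_charge/= /charge_of_finite_measure.
rewrite /= diracE memNset// => xE.
by suff : (E `&` [set x]) x by rewrite Ex.
Qed.

Definition delta : M R X := M_of_charge dirac_supported.

End dirac.

Section pushforward.
Context (R : realType) d d' (X : bornMeasType d) (Y : bornMeasType d').
Variables (f : bornMeasHom X Y) (mu : M R X).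

Let map : set Y -> \bar R := pushforward mu f.

Let mf A : measurable A -> measurable (f @^-1` A).
Proof. by move=> mA; rewrite -[X in measurable X]setTI; exact: hom_measurable. Qed.

Let map0 : map set0 = 0%E.
Proof. by rewrite /map /pushforward preimage_set0 charge0. Qed.

Let map_fin A : measurable A -> map A \is a fin_num.
Proof. by move=> mA; apply: (fin_num_measure mu); exact: mf. Qed.

Let map_sigma_additive : semi_sigma_additive map.
Proof.
move=> F mF tF mUF; rewrite /map /pushforward preimage_bigcup.
apply: charge_semi_sigma_additive.
- by move=> n; exact: mf.
- by move=> i j _ _ [x [Fix Fjx]]; apply: tF => //; exists (f x).
- by rewrite -preimage_bigcup; exact: mf.
Qed.

HB.instance Definition _ := isCharge.Build _ _ _ map map0 map_fin map_sigma_additive.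

Definition pushforward_charge : {charge set Y -> \bar R} := map.

Lemma pushforward_supported :
  exists2 B : set Y, bornology B & supported pushforward_charge B.
Proof.
have [B bB /supportedP muB] := M_supported mu.
exists (f @` B); first exact: hom_bornological.
apply/supportedP => E mE EB; apply: muB; first exact: mf.
apply/seteqP; split=> // x [Efx Bx].
by suff : (E `&` f @` B) (f x) by rewrite EB.
Qed.

Definition Mmap : M R Y := M_of_charge pushforward_supported.

End pushforward.

Section kappa_integrals.
Context (R : realType) d (X : bornMeasType d).
Variables (B : set X) (gamma : R).
Variable m : {finite_measure set (M R X) -> \bar R}.
Hypothesis m0 : forall Z, measurable Z -> Z `&` M_ball B gamma = set0 -> m Z = 0%E.

Let I (E : set X) : R := \int[m]_mu Ev E mu.

Let EvE (E : set X) (mu : M R X) : measurable E -> (Ev E mu)%:E = mu E.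
Proof. by move=> mE; rewrite /Ev fineK// fin_num_measure. Qed.

Let Ev_le (E : set X) (mu : M R X) : measurable E -> M_ball B gamma mu ->
  `|Ev E mu| <= gamma.
Proof.
move=> mE [_]; apply: le_trans.
rewrite -lee_fin /variation_norm fineK; last first.
  by rewrite /variation fin_num_measure.
have -> : (`|Ev E mu|%:E = `|mu E|)%E by rewrite -EvE.
rewrite (le_trans (abse_charge_variation (hahnP mu) mE))//.
by rewrite /variation le_measure// inE.
Qed.

Let measurable_big (E : set X) : measurable E ->
  measurable [set mu : M R X | gamma < `|Ev E mu|].
Proof.
move=> mE.
have mf : measurable_fun setT (normr \o Ev E : M R X -> R).
  by apply: measurableT_comp => //; exact: measurable_Ev.
have := mf measurableT `]gamma, +oo[%classic (measurable_itv _).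
rewrite setTI; congr measurable; apply/seteqP; split=> mu /=.
  by rewrite in_itv/= andbT.
by rewrite in_itv/= andbT.
Qed.

Let ae_bounded (E : set X) : measurable E ->
  {ae m, forall mu : M R X, `|Ev E mu| <= gamma}.
Proof.
move=> mE; exists [set mu : M R X | gamma < `|Ev E mu|]; split.
- exact: measurable_big.
- apply: m0; first exact: measurable_big.
  apply/seteqP; split=> // mu /= [h /Ev_le] => /(_ _ mE).
  by rewrite leNgt h.
- by move=> mu /= /negP; rewrite -ltNge.
Qed.

Let dct (F : (set X)^nat) (E : set X) :
  (forall n, measurable (F n)) -> measurable E ->
  (forall mu : M R X, Ev (F n) mu @[n --> \oo] --> Ev E mu) ->
  m.-integrable setT (EFin \o Ev E) /\ I (F n) @[n --> \oo] --> I E.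
Proof.
move=> mF mE FE.
have [] := @dominated_convergence _ _ _ m setT measurableT
  (fun n => EFin \o Ev (F n)) (EFin \o Ev E) (EFin \o cst gamma).
- by move=> n; apply/measurable_EFinP; exact: measurable_Ev.
- by apply/measurable_EFinP; exact: measurable_Ev.
- by apply: aeW => mu _; apply: cvg_EFin; [exact: nearW|exact: FE].
- exact: finite_measure_integrable_cst.
- have := ae_foralln (fun n => ae_bounded (mF n)).
  by apply: filterS => mu h n _; rewrite /= lee_fin.
move=> iE _ cE; split=> //; apply: fine_cvg.
rewrite fineK; first exact: cE.
exact: integrable_fin_num.
Qed.

Lemma integrable_Ev (E : set X) : measurable E -> m.-integrable setT (EFin \o Ev E).
Proof. by move=> mE; have [] := @dct (fun=> E) E => // mu; exact: cvg_cst. Qed.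

Let IU (E F : set X) : measurable E -> measurable F -> E `&` F = set0 ->
  I (E `|` F) = I E + I F.
Proof.
move=> mE mF EF; rewrite -RintegralD//; [|exact: integrable_Ev..].
apply: eq_Rintegral => mu _.
by rewrite /Ev chargeU// fineD// fin_num_measure.
Qed.

Lemma kappa_integral0 (E : set X) : measurable E -> E `&` B = set0 -> I E = 0.
Proof.
move=> mE EB; rewrite /I /Rintegral (ae_eq_integral (cst 0%E))//.
- by rewrite integral0.
- by apply/measurable_EFinP; exact: measurable_Ev.
have mZ : measurable [set mu : M R X | Ev E mu != 0].
  have := @measurable_Ev R _ X E mE measurableT (~` [set 0]).
  rewrite setTI => /(_ (measurableC (measurable_set1 _))).
  congr measurable; apply/seteqP; split=> mu /=; first by move=> /eqP.
  by move=> /eqP.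
exists [set mu : M R X | Ev E mu != 0]; split => //.
  apply: m0 => //; apply/seteqP; split => // mu [/= + [/supportedP muB _]].
  by rewrite /Ev muB// eqxx.
by move=> mu /= h; apply/eqP => e; apply: h => _; rewrite e.
Qed.

Lemma kappa_integral_sigma (F : (set X)^nat) :
  (forall n, measurable (F n)) -> trivIset setT F ->
  \sum_(0 <= i < n) I (F i) @[n --> \oo] --> I (\bigcup_n F n).
Proof.
move=> mF tF.
pose G n := \big[setU/set0]_(i < n) F i.
have mG n : measurable (G n) by exact: bigsetU_measurable.
have mU : measurable (\bigcup_n F n) by exact: bigcup_measurable.
have -> : (fun n => \sum_(0 <= i < n) I (F i)) = (fun n => I (G n)).
  apply/funext; elim=> [|n ih].
    rewrite big_geq// /G big_ord0 /I /Rintegral integral0_eq// => mu _.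
    by rewrite /Ev charge0.
  rewrite big_nat_recr//= ih /G big_ord_recr/= IU//; first exact: mG.
  rewrite -bigcup_mkord; apply/seteqP; split=> // x [[k /= kn Fkx] Fnx].
  by have kn' : k = n; [apply: tF => //; exists x|rewrite kn' ltnn in kn].
have [|_ //] := dct mG mU.
move=> mu; apply: fine_cvg; rewrite fineK ?fin_num_measure//.
have := @charge_semi_sigma_additive _ _ _ (M_charge mu) F mF tF mU.
rewrite (_ : (fun n => _) = fun n => mu (G n)) //.
apply/funext => n; rewrite big_mkord charge_semi_additive //; exact: mG.
Qed.

End kappa_integrals.

Section kappa.
Context (R : realType) d (X : bornMeasType d) (MM : M R (M R X)).

Lemma MM_supported : exists B gamma,
  [/\ bornology B & supported MM (@M_ball R _ X B gamma)].
Proof.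
have [S [B [g [bB g0 SB]]] sS] := M_supported MM.
exists B, g; split=> //; exact: supported_sub sS.
Qed.

Let MM_pos B gamma : supported MM (@M_ball R _ X B gamma) ->
  forall Z, measurable Z -> Z `&` M_ball B gamma = set0 ->
  positive_part MM Z = 0%E.
Proof.
move=> /supportedP sMM Z mZ ZB; rewrite /positive_part jordan_posE cjordan_posE.
rewrite /crestr0 mem_set// /crestr; have [[mP _] _ _ _] := hahnP MM.
by apply: sMM; [exact: measurableI|rewrite setIAC ZB set0I].
Qed.

Let MM_neg B gamma : supported MM (@M_ball R _ X B gamma) ->
  forall Z, measurable Z -> Z `&` M_ball B gamma = set0 ->
  negative_part MM Z = 0%E.
Proof.
move=> /supportedP sMM Z mZ ZB; rewrite /negative_part jordan_negE cjordan_negE.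
rewrite /crestr0 mem_set// /crestr; have [_ [mN _] _ _] := hahnP MM.
by rewrite sMM ?oppe0//; [exact: measurableI|rewrite setIAC ZB set0I].
Qed.

(* M_of_charge below discards the values at non-measurable E. *)
Let kappa_fun (E : set X) : \bar R := (charge_integral MM (Ev E))%:E.

Let kappa_fun0 (B : set X) gamma E : supported MM (@M_ball R _ X B gamma) ->
  measurable E -> E `&` B = set0 -> kappa_fun E = 0%E.
Proof.
move=> sMM mE EB; rewrite /kappa_fun /charge_integral.
by rewrite (kappa_integral0 (MM_pos sMM))// (kappa_integral0 (MM_neg sMM))// subrr.
Qed.

Let kappa0 : kappa_fun set0 = 0%E.
Proof.
have [B [g [_ sMM]]] := MM_supported.
by apply: (kappa_fun0 sMM) => //; rewrite set0I.
Qed.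

Let kappa_fin E : measurable E -> kappa_fun E \is a fin_num.
Proof. by []. Qed.

Let kappa_sigma_additive : semi_sigma_additive kappa_fun.
Proof.
move=> F mF tF mUF; have [B [g [_ sMM]]] := MM_supported.
have cpos := kappa_integral_sigma (MM_pos sMM) mF tF.
have cneg := kappa_integral_sigma (MM_neg sMM) mF tF.
rewrite (_ : (fun n => _) = EFin \o (fun n =>
    \sum_(0 <= i < n) (\int[positive_part MM]_mu Ev (F i) mu)
    - \sum_(0 <= i < n) (\int[negative_part MM]_mu Ev (F i) mu))).
  by apply: cvg_EFin; [exact: nearW|exact: cvgB cpos cneg].
by apply/funext => n; rewrite sumEFin/= -sumrB.
Qed.

HB.instance Definition _ := isCharge.Build _ _ _ kappa_fun
  kappa0 kappa_fin kappa_sigma_additive.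

Definition kappa_charge : {charge set X -> \bar R} := kappa_fun.

Lemma kappa_supported : exists2 B : set X, bornology B & supported kappa_charge B.
Proof.
have [B [g [bB sMM]]] := MM_supported; exists B => //.
by apply/supportedP => E mE EB; exact: (kappa_fun0 sMM).
Qed.

Definition kappa : M R X := M_of_charge kappa_supported.

Lemma kappaE E : measurable E -> kappa E = (charge_integral MM (Ev E))%:E.
Proof. by move=> mE; rewrite M_of_chargeE. Qed.

End kappa.

Record M_algebra (R : realType) d (X : bornMeasType d)
    (c : bornMeasHom (M R X) X) : Prop := {
  M_algebra_unit : c \o @delta R d X = idfun ;
  M_algebra_assoc : c \o Mmap c = c \o @kappa R d X
}.

Section weak.
Context {R : realType} (X : normedModType R).

Definition weak : Type := X.

HB.instance Definition _ := Choice.on weak.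
HB.instance Definition _ := isPointed.Build weak (0 : X).

Definition weak_sigma_algebra : set (set weak) :=
  <<s \bigcup_(phi in [set: dual_space X])
        preimage_set_system setT (phi : X -> R) measurable >>.

Let weak_measurableC (U : set weak) :
  weak_sigma_algebra U -> weak_sigma_algebra (~` U).
Proof. by move=> mU; rewrite -setTD; exact: sigma_algebraCD. Qed.

Definition weak_display : measure_display.
Proof. by constructor. Qed.

HB.instance Definition _ := @isMeasurable.Build weak_display weak
  weak_sigma_algebra
  (@sigma_algebra0 _ _ _) weak_measurableC (@sigma_algebra_bigcup _ _ _).

Definition norm_bornology : set (set weak) := [set A : set X | bounded_set A].

Let norm_bornology0 : norm_bornology set0.
Proof. by rewrite /norm_bornology/= /bounded_near; near=> r => x [].
Unshelve. all: by end_near. Qed.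

Let norm_bornology_sub A B :
  A `<=` B -> norm_bornology B -> norm_bornology A.
Proof.
move=> AB; rewrite /norm_bornology/= /bounded_near.
by apply: filterS => r Br x /AB; exact: Br.
Qed.

Let norm_bornologyU A B :
  norm_bornology A -> norm_bornology B -> norm_bornology (A `|` B).
Proof.
rewrite /norm_bornology/= /bounded_near.
by apply: filterS2 => r Ar Br x [/Ar|/Br]. Qed.

Let norm_bornology1 (x : weak) : norm_bornology [set x].
Proof.
have : \forall r \near +oo, `|x : X| <= r by exact: nbhs_pinfty_ge.
by apply: filterS => r xr _ ->.
Qed.

HB.instance Definition _ := isBornological.Build weak
  norm_bornology0 norm_bornology_sub norm_bornologyU norm_bornology1.

End weak.

Section pettis.
Context {R : realType} (X : normedModType R).

Definition weakly_measurable d (T : measurableType d) (f : T -> X) : Prop :=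
  forall phi : dual_space X, measurable_fun setT (phi \o f : T -> R).

Definition pettis_integral d (T : measurableType d)
    (mu : {charge set T -> \bar R}) (f : T -> X) (x : X) : Prop :=
  forall phi : dual_space X,
    charge_integrable mu (phi \o f) /\ phi x = charge_integral mu (phi \o f).

(* The empty measurable space, not a measurableType, carries only the zero
   measure, for which 0 is a Pettis integral. *)
Definition enough_pettis_integrals : Prop :=
  forall d (T : measurableType d) (f : T -> X),
    weakly_measurable f -> bounded_set (range f) ->
  forall mu : {charge set T -> \bar R}, exists x, pettis_integral mu f x.

End pettis.

(* Main.v *)
Require Import Defs.
From mathcomp Require Import all_boot all_order all_algebra.
From mathcomp Require Import all_classical all_reals all_analysis.
From mathcomp Require Import measurable_realfun lra.

Set Implicit Arguments.
Unset Strict Implicit.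
Unset Printing Implicit Defensive.

Import Order.TTheory GRing.Theory Num.Def Num.Theory.
Import numFieldNormedType.Exports.

Local Open Scope classical_set_scope.
Local Open Scope ring_scope.

(** The two existence claims are instances of one fact: if [mu] is supported by
    a set [A] on which a weakly measurable [f] is bounded, then [f] has a Pettis
    integral.  Taking [A] to be the whole space gives enough Pettis integrals;
    taking for [A] a bounded support of [mu] and for [f] the identity gives the
    structure map [c], the barycenter.

    Existence means that the bounded functional [L : phi |-> int phi o f dmu] on
    the dual is evaluation at a vector.  For a reflexive space this is the
    definition ([reflexive_pettis]).  For a separable space, countably many
    functionals of norm at most 1 compute the norm, so that closed balls have
    measurable preimages under [f]; cutting the domain along balls of radius [e]
    centred at a dense sequence makes [f] within [e] of a finitely valued
    function, up to a set of small variation.  The Pettis integrals of these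
    functions are finite sums, and approximate [L] uniformly on the unit ball of
    the dual ([separable_pettis]).  By the Hahn-Banach theorem such vectors form
    a Cauchy sequence, and its limit represents [L] ([dual_approximation]).

    For the algebra structure, Hahn-Banach reduces every assertion about [c] to
    one about the scalars [phi (c mu) = int phi dmu].  These are handled by
    approximating [phi] by simple functions, which stay below [|phi|] so that
    dominated convergence applies: measurability of [mu |-> int phi dmu], change
    of variables, and the iterated integral formula for [kappa] are thereby
    reduced to indicator functions, for which they hold by definition.  Bounded
    sets go to bounded sets because [|int phi dmu|] is at most the supremum of
    [|phi|] on a support times the norm of [mu]. *)

(** * The Hahn-Banach theorem *)

Section hahn_banach.
Context {R : realType} (X : normedModType R).
Implicit Types (G : set (X * R)) (x y : X) (a r s : R).

(** Partial functionals are represented by their graphs, for which the union of a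
    chain is a plain union.  A linear graph dominated by the norm is functional,
    since the difference of two values at [x] is at most [|0|] in both
    directions. *)
Definition linear_graph G : Prop := forall a x r y s,
  G (x, r) -> G (y, s) -> G (a *: x + y, a * r + s).

Definition norm_dominated G : Prop := forall x r, G (x, r) -> r <= `|x|.

(** The value at [x1] is the supremum of the lower bounds that domination imposes
    on it; the triangle inequality puts each of them below every upper bound. *)
Lemma one_step_extension G x1 : G (0, 0) -> linear_graph G -> norm_dominated G ->
  exists G' s, [/\ linear_graph G', norm_dominated G', G `<=` G' & G' (x1, s)].
Proof.
move=> G0 lG dG.
have GZ a x r : G (x, r) -> G (a *: x, a * r).
  by move=> Gx; have := lG a _ _ _ _ Gx G0; rewrite !addr0.
pose S := [set p.2 - `|p.1 - x1| | p in G].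
have Sub y r : G (y, r) -> ubound S (`|y + x1| - r).
  move=> Gy _ [[z t] Gz <-] /=; rewrite lerBrDr addrAC lerBlDr.
  have := dG _ _ (lG 1 _ _ _ _ Gz Gy); rewrite scale1r mul1r => /le_trans; apply.
  rewrite (_ : z + y = (y + x1) + (z - x1)) ?ler_normD//.
  by rewrite addrACA subrr addr0 addrC.
have hS : has_sup S.
  split; first by exists (0 - `|0 - x1|), (0, 0).
  by exists (`|0 + x1| - 0); exact: Sub.
exists [set p | exists y r a, G (y, r) /\ p = (y + a *: x1, r + a * sup S)], (sup S).
split.
- move=> a _ _ _ _ [y [r [b [Gy [-> ->]]]]] [z [t [c [Gz [-> ->]]]]].
  exists (a *: y + z), (a * r + t), (a * b + c); split; first exact: lG.
  congr (_, _); last by lra.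
  by rewrite scalerDr scalerDl !scalerA addrACA.
- move=> _ _ [y [r [a [Gy [-> ->]]]]].
  have [->|a0] := eqVneq a 0; first by rewrite mul0r scale0r !addr0; exact: dG.
  (* Dividing by [|a|] reduces to the coefficients 1 and -1. *)
  have -> : r + a * sup S = `|a| * (r / `|a| + Num.sg a * sup S).
    rewrite mulrDr mulrCA divff ?normr_eq0// mulr1 mulrA mulrC.
    by rewrite (mulrC `|a|) -numEsg mulrC.
  have -> : `|y + a *: x1| = `|a| * `| `|a|^-1 *: y + Num.sg a *: x1|.
    rewrite -[X in X * _]normr_id -normrZ scalerDr !scalerA divff ?normr_eq0//.
    by rewrite scale1r (mulrC `|a|) -numEsg.
  rewrite ler_wpM2l//.
  have := GZ `|a|^-1 _ _ Gy; rewrite (mulrC _ r).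
  move: (_ *: y) (r / _) => z t Gz.
  have [a00|ap|an] := sgrP a.
  + by rewrite a00 eqxx in a0.
  + rewrite mul1r scale1r -lerBrDl; apply: ge_sup; first by case: hS.
    exact: Sub.
  + rewrite mulN1r scaleN1r lerBlDr -lerBlDl; apply: ub_le_sup; first by case: hS.
    by exists (z, t).
- by move=> [y r] Gy; exists y, r, 0; split=> //; rewrite scale0r mul0r !addr0.
- by exists 0, 0, 1; split => //; rewrite scale1r mul1r !add0r.
Qed.

Lemma maximal_extension G0 : G0 (0, 0) -> linear_graph G0 -> norm_dominated G0 ->
  exists G, [/\ linear_graph G, norm_dominated G, G0 `<=` G &
    forall x, exists r, G (x, r)].
Proof.
move=> G00 lG0 dG0.
(* Adding [G0] inside the predicate makes it hold of the empty union, as Zorn's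
   lemma requires. *)
pose P G := linear_graph (G0 `|` G) /\ norm_dominated (G0 `|` G).
have [F FP totF|G [[lG dG] maxG]] := @Zorn_bigcup _ P.
  have FE p : (G0 `|` \bigcup_(X in F) X) p -> G0 p \/ exists2 G, F G & (G0 `|` G) p.
    by case=> [?|[G FG Gp]]; [left|right; exists G => //; right].
  have sub G p : F G -> (G0 `|` G) p -> (G0 `|` \bigcup_(X in F) X) p.
    by move=> FG [?|?]; [left|right; exists G].
  split.
    move=> a x r y s /FE[Gx|[G FG Gx]] /FE[Gy|[G' FG' Gy]].
    - by left; exact: lG0.
    - by apply: (sub G') => //; apply: (FP _ FG').1 => //; left.
    - by apply: (sub G) => //; apply: (FP _ FG).1 => //; left.
    - have [GG'|G'G] := totF _ _ FG FG'.
        apply: (sub G') => //; apply: (FP _ FG').1 => //.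
        by case: Gx => [|/GG']; [left|right].
      apply: (sub G) => //; apply: (FP _ FG).1 => //.
      by case: Gy => [|/G'G]; [left|right].
  by move=> x r /FE[/dG0//|[G FG]]; apply: (FP _ FG).2.
exists (G0 `|` G); split => // x.
have [||//|G' [s [lG' dG' GG' G's]]] := @one_step_extension (G0 `|` G) x.
- by left.
- by [].
have G0G' : G0 `|` G' = G'.
  by apply/seteqP; split => [p [G0p|//]|p]; [apply: GG'; left|right].
exists s; apply: contrapT => nG; apply: (maxG G'); last first.
  by split; rewrite G0G'.
split; first by move=> p Gp; apply: GG'; right.
by move=> /(_ _ G's) Gs; apply: nG; right.
Qed.

(** The functional [a *: x0 |-> a * |x0|] on the line through [x0], extended to
    the whole space. *)
Lemma hahn_banach_norming x0 : exists phi : dual_space X,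
  (forall x, `|phi x| <= `|x|) /\ phi x0 = `|x0|.
Proof.
have [|||G [lG dG G0G totG]] := @maximal_extension
    [set p | exists a, p = (a *: x0, a * `|x0|)].
- by exists 0; rewrite scale0r mul0r.
- move=> a _ _ _ _ [b [-> ->]] [c [-> ->]]; exists (a * b + c).
  by rewrite scalerDl mulrDl scalerA mulrA.
- move=> _ _ [a [-> ->]]; rewrite normrZ ler_wpM2r//.
  exact: ler_norm.
- have G00 : G (0, 0) by apply: G0G; exists 0; rewrite scale0r mul0r.
  have GN x r : G (x, r) -> G (- x, - r).
    by move=> Gx; have := lG (-1) _ _ _ _ Gx G00; rewrite !addr0 scaleN1r mulN1r.
  have Guniq x r s : G (x, r) -> G (x, s) -> r = s.
    have le r' s' : G (x, r') -> G (x, s') -> r' <= s'.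
      move=> Gr Gs; rewrite -subr_le0; have := dG _ _ (lG 1 _ _ _ _ Gr (GN _ _ Gs)).
      by rewrite scale1r mul1r subrr normr0.
    by move=> Gr Gs; apply/eqP; rewrite eq_le !le.
  have [f fG] := choice totG.
  have fl : linear (f : X -> R^o).
    by move=> a x y; apply: (Guniq (a *: x + y)) => //; exact: lG.
  have fb x : `|f x| <= `|x|.
    by rewrite ler_norml lerNl -{1}(normrN x) !dG//; exact: GN.
  have fB : (f : X -> R^o) \in bounded_functional X.
    by rewrite inE; split=> //; exists 1 => x; rewrite mul1r.
  exists (DualSpace fB); split => //=.
  by apply: (Guniq x0) => //; apply: G0G; exists 1; rewrite scale1r mul1r.
Qed.

Lemma dual_norm_bound x C :
  (forall phi : dual_space X, dual_norm phi <= 1 -> phi x <= C) -> `|x| <= C.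
Proof.
move=> xC; have [phi [phi1 <-]] := hahn_banach_norming x; apply: xC.
by apply: dual_norm_le => y y1; exact: le_trans (phi1 y) y1.
Qed.

Lemma dual_separates x y : (forall phi : dual_space X, phi x = phi y) -> x = y.
Proof.
move=> xy; apply/eqP; rewrite -subr_eq0 -normr_le0; apply: dual_norm_bound => phi _.
by rewrite linearB /= xy subrr.
Qed.

End hahn_banach.

(** * Approximation by simple functions *)

Section simple_approximation.
Context d {T : measurableType d} {R : realType}.
Implicit Types (f g : T -> R) (P : (T -> R) -> Prop).

Definition simple_closed P : Prop :=
  (forall E, measurable E -> P \1_E) /\
  (forall a f g, measurable_fun setT f -> measurable_fun setT g ->
    P f -> P g -> P (fun x => a * f x + g x)).

(** The simple functions, given by their induction principle: the smallest class
    closed in the above sense. *)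
Definition simple_function f : Prop := forall P, simple_closed P -> P f.

Lemma simple_closed_measurable : simple_closed (measurable_fun setT).
Proof.
split=> [E mE|a f g mf mg _ _]; first exact: measurable_indic.
by apply: measurable_funD => //; exact: measurable_funM.
Qed.

Lemma simple_function_comb a f g :
  simple_function f -> simple_function g -> simple_function (fun x => a * f x + g x).
Proof.
move=> sf sg P clP; apply: clP.2; [| |exact: sf|exact: sg].
- by apply: sf; exact: simple_closed_measurable.
- by apply: sg; exact: simple_closed_measurable.
Qed.

Import HBNNSimple.

Lemma simple_function_nnsfun (f : {nnsfun T >-> R}) : simple_function f.
Proof.
pose t (l : seq R) x := \sum_(y <- l) (y * \1_(f @^-1` [set y]) x).
have st l : simple_function (t l).
  elim: l => [P clP|y l sl].
    rewrite (_ : t [::] = \1_set0); first by apply: clP.1; exact: measurable0.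
    by apply/funext => x; rewrite /t big_nil indicE in_set0.
  rewrite (_ : t (y :: l) = fun x => y * \1_(f @^-1` [set y]) x + t l x).
    apply: simple_function_comb => // P clP; apply: clP.1.
    exact: measurable_funPTI.
  by apply/funext => x; rewrite /t big_cons.
rewrite (_ : (f : T -> R) = t (finmap.enum_fset (fset_set (range f)))) //.
by apply/funext => x; rewrite fimfunE fsbig_finite.
Qed.

Lemma ge0_simple_approximation f : measurable_fun setT f -> (forall x, 0 <= f x) ->
  exists s : nat -> T -> R, [/\ forall n, simple_function (s n),
    forall n x, 0 <= s n x <= f x & forall x, s n x @[n --> \oo] --> f x].
Proof.
move=> mf f0; have mEf : measurable_fun setT (EFin \o f) by exact/measurable_EFinP.
pose s n : T -> R := nnsfun_approx measurableT mEf n.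
have cs x : s n x @[n --> \oo] --> f x.
  have := @cvg_nnsfun_approx _ _ _ _ measurableT _ mEf (fun x _ => f0 x) x I.
  by move=> /fine_cvg.
exists s; split=> // [n|n x]; first exact: simple_function_nnsfun.
apply/andP; split; first exact: fun_ge0.
rewrite -(cvg_lim _ (cs x))//; apply: nondecreasing_cvgn_le.
  by move=> m k mk; exact/lefP/nd_nnsfun_approx.
by apply/cvg_ex; exists (f x); exact: cs.
Qed.

(** The bound by [|f|] makes the convergence dominated for every measure that
    integrates [f], so that one sequence serves for all of them. *)
Lemma simple_approximation f : measurable_fun setT f ->
  exists s : nat -> T -> R, [/\ forall n, simple_function (s n),
    forall n x, `|s n x| <= `|f x| & forall x, s n x @[n --> \oo] --> f x].
Proof.
move=> mf.
have [u [su u0 uf]] :=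
  ge0_simple_approximation (measurable_funrpos mf) (@funrpos_ge0 _ _ f).
have [v [sv v0 vf]] :=
  ge0_simple_approximation (measurable_funrneg mf) (@funrneg_ge0 _ _ f).
exists (fun n x => -1 * v n x + u n x); split=> [n|n x|x].
- exact: simple_function_comb.
- have /andP[u1 u2] := u0 n x; have /andP[v1 v2] := v0 n x.
  have -> : `|f x| = f^\+ x + f^\- x.
    by rewrite -[LHS]/((Num.norm \o f) x) -funrposDneg.
  by rewrite ler_norml; apply/andP; split; lra.
- have -> : f x = -1 * f^\- x + f^\+ x.
    by rewrite -{1}(funrposBneg f) mulN1r addrC.
  by apply: cvgD (uf x); apply: cvgM (vf x); exact: cvg_cst.
Qed.

End simple_approximation.

(** * Integration against finite signed measures *)

Section concentrated_measures.
Context d {T : measurableType d} {R : realType}.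
Implicit Types (m : {measure set T -> \bar R}) (A : set T) (f g : T -> R).

(** [A] need not be measurable, so this is not the nullity of its complement. *)
Definition concentrated m A : Prop :=
  forall Z, measurable Z -> Z `&` A = set0 -> m Z = 0%E.

(** An inequality between measurable functions that holds on [A] fails only on a
    measurable set disjoint from [A]. *)
Lemma concentrated_ae m A f g : concentrated m A ->
  measurable_fun setT f -> measurable_fun setT g ->
  (forall x, A x -> f x <= g x) -> {ae m, forall x, f x <= g x}.
Proof.
move=> mA mf mg fg.
have mZ : measurable [set x | g x < f x].
  rewrite (_ : [set _ | _] = (fun x => g x < f x) @^-1` [set true]).
    by rewrite -[X in measurable X]setTI; exact: measurable_fun_ltr.
  by apply/seteqP; split.
exists [set x | g x < f x]; split=> //.
  apply: mA => //; apply/seteqP; split=> // x [/= gf /fg].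
  by rewrite leNgt gf.
by move=> x /= /negP; rewrite -ltNge.
Qed.

Lemma concentrated_dominated_convergence m A (f_ : nat -> T -> R) f g :
  concentrated m A -> (forall n, measurable_fun setT (f_ n)) ->
  m.-integrable setT (EFin \o g) ->
  (forall n x, A x -> `|f_ n x| <= g x) ->
  (forall x, f_ n x @[n --> \oo] --> f x) ->
  m.-integrable setT (EFin \o f) /\
  \int[m]_x f_ n x @[n --> \oo] --> \int[m]_x f x.
Proof.
move=> mA mf_ ig fg ff.
have mg : measurable_fun setT g by apply/measurable_EFinP; case/integrableP: ig.
have mf : measurable_fun setT f.
  by apply: (measurable_fun_cvg mf_) => x _; exact: ff.
have [] := @dominated_convergence _ _ _ m setT measurableT
    (fun n => EFin \o f_ n) (EFin \o f) (EFin \o g).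
- by move=> n; exact/measurable_EFinP.
- exact/measurable_EFinP.
- by apply: aeW => x _; apply: cvg_EFin; [exact: nearW|exact: ff].
- exact: ig.
- have := ae_foralln (fun n => concentrated_ae mA
    (measurableT_comp (@normr_measurable R setT) (mf_ n)) mg (fg n)).
  by apply: filterS => x h n _; rewrite /= lee_fin; exact: h.
move=> iF _ cF; split=> //; apply: fine_cvg.
by rewrite fineK; [exact: cF|exact: integrable_fin_num].
Qed.

Lemma integrable_comb m a f g : m.-integrable setT (EFin \o f) ->
  m.-integrable setT (EFin \o g) ->
  m.-integrable setT (EFin \o (fun x => a * f x + g x)).
Proof.
move=> fi gi.
rewrite (_ : EFin \o _ = (fun x => a%:E * (EFin \o f) x) \+ (EFin \o g))%E//.
by apply: integrableD => //; exact: integrableZl.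
Qed.

Lemma Rintegral_comb m a f g : m.-integrable setT (EFin \o f) ->
  m.-integrable setT (EFin \o g) ->
  \int[m]_x (a * f x + g x) = a * \int[m]_x f x + \int[m]_x g x.
Proof.
move=> fi gi; rewrite RintegralD//; first by rewrite RintegralZl.
rewrite (_ : EFin \o _ = (fun x => a%:E * (EFin \o f) x))%E//.
exact: integrableZl.
Qed.

End concentrated_measures.

Section charge_integral_theory.
Context d {T : measurableType d} {R : realType}.
Variable mu : {charge set T -> \bar R}.
Implicit Types (f g : T -> R) (A Z : set T).

Local Notation pos := (positive_part mu).
Local Notation neg := (negative_part mu).

Lemma charge_integrableP f : charge_integrable mu f <->
  pos.-integrable setT (EFin \o f) /\ neg.-integrable setT (EFin \o f).
Proof.
have vE : measurable_fun setT (EFin \o f) ->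
    (\int[Defs.variation mu]_x `|(EFin \o f) x| =
     \int[pos]_x `|(EFin \o f) x| + \int[neg]_x `|(EFin \o f) x|)%E.
  move=> mf; rewrite (@eq_measure_integral _ _ _ _ (measure_add pos neg)).
    by rewrite ge0_integral_measure_add//; exact: measurableT_comp.
  by move=> A _ _; rewrite [RHS]measure_addE.
split=> [/integrableP[mf]|[/integrableP[mf pf] /integrableP[_ nf]]].
  rewrite vE// => foo; split; apply/integrableP; split=> //;
    by apply: le_lt_trans foo; rewrite ?leeDl ?leeDr// integral_ge0.
by apply/integrableP; split=> //; rewrite vE// lte_add_pinfty.
Qed.

(** The positive and negative parts are restrictions of [mu] up to sign, so they
    vanish wherever all measurable subsets are null for [mu]. *)
Lemma supported_concentrated A : supported mu A ->
  concentrated pos A /\ concentrated neg A.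
Proof.
move=> /supportedP muA.
have [[mP _] [mN _] _ _] := hahnP mu.
have p0 : concentrated pos A.
  move=> Z mZ ZA; rewrite -[LHS]/(positive_part mu Z) /positive_part.
  rewrite jordan_posE cjordan_posE.
  rewrite /crestr0 mem_set// /crestr.
  by apply: muA; [exact: measurableI|rewrite setIAC ZA set0I].
have n0 : concentrated neg A.
  move=> Z mZ ZA; rewrite -[LHS]/(negative_part mu Z) /negative_part.
  rewrite jordan_negE cjordan_negE.
  rewrite /crestr0 mem_set// /crestr.
  by rewrite muA ?oppe0//; [exact: measurableI|rewrite setIAC ZA set0I].
by split.
Qed.

Lemma variation_fin A : measurable A ->
  (fine (Defs.variation mu A))%:E = Defs.variation mu A.
Proof. by move=> mA; rewrite fineK// /Defs.variation fin_num_measure. Qed.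

Lemma charge_norm_ge0 : 0 <= variation_norm mu.
Proof. exact/fine_ge0/measure_ge0. Qed.

Lemma charge_integrable_indic A : measurable A -> charge_integrable mu \1_A.
Proof. by move=> mA; apply/charge_integrableP; split; exact: integrable_indic. Qed.

Lemma charge_integrable_cst (a : R) : charge_integrable mu (fun=> a).
Proof.
by apply/charge_integrableP; split; exact: finite_measure_integrable_cst.
Qed.

Lemma charge_integrable_measurable f : charge_integrable mu f -> measurable_fun setT f.
Proof. by move=> /integrableP[mf _]; exact/measurable_EFinP. Qed.

Lemma charge_integral_indic A : measurable A -> charge_integral mu \1_A = fine (mu A).
Proof.
move=> mA; rewrite /charge_integral /Rintegral !integral_indic// setIT.
rewrite [in RHS](jordan_decomp (hahnP mu) mA) /cadd/= cscaleN1.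
by rewrite fineB//; exact: fin_num_measure.
Qed.

Lemma charge_integrable_comb a f g :
  charge_integrable mu f -> charge_integrable mu g ->
  charge_integrable mu (fun x => a * f x + g x).
Proof. exact: integrable_comb. Qed.

Lemma charge_integral_comb a f g :
  charge_integrable mu f -> charge_integrable mu g ->
  charge_integral mu (fun x => a * f x + g x) =
  a * charge_integral mu f + charge_integral mu g.
Proof.
move=> /charge_integrableP[pf nf] /charge_integrableP[pg ng].
rewrite /charge_integral.
rewrite !Rintegral_comb//.
by rewrite mulrBr opprD addrACA.
Qed.

Lemma charge_dominated_convergence A (f_ : nat -> T -> R) f g :
  supported mu A -> (forall n, measurable_fun setT (f_ n)) ->
  charge_integrable mu g ->
  (forall n x, A x -> `|f_ n x| <= g x) ->
  (forall x, f_ n x @[n --> \oo] --> f x) ->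
  charge_integrable mu f /\
  charge_integral mu (f_ n) @[n --> \oo] --> charge_integral mu f.
Proof.
move=> /supported_concentrated[pA nA] mf_ /charge_integrableP[pg ng] fg ff.
have [pf pc] := concentrated_dominated_convergence pA mf_ pg fg ff.
have [nf nc] := concentrated_dominated_convergence nA mf_ ng fg ff.
by split; [exact/charge_integrableP|exact: cvgB].
Qed.

Lemma dominated_charge_integrable A f g :
  supported mu A -> measurable_fun setT f -> charge_integrable mu g ->
  (forall x, A x -> `|f x| <= g x) -> charge_integrable mu f.
Proof.
move=> muA mf gi fg.
have [] // := @charge_dominated_convergence A (fun=> f) f g muA (fun=> mf) gi (fun=> fg).
by move=> x; exact: cvg_cst.
Qed.

(** The exceptional set [Z], where only the worse bound [a + b] is known, serves
    for a finitely valued function that approximates well off [Z]. *)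
Lemma charge_integral_le A f Z a b :
  supported mu A -> measurable_fun setT f -> measurable Z -> 0 <= a -> 0 <= b ->
  (forall x, A x -> `|f x| <= a + b * \1_Z x) ->
  `|charge_integral mu f| <= a * variation_norm mu + b * fine (Defs.variation mu Z).
Proof.
move=> muA mf mZ a0 b0 fab.
have [pA nA] := supported_concentrated muA.
have ig : charge_integrable mu (fun x => b * \1_Z x + a).
  apply: charge_integrable_comb; [exact: charge_integrable_indic|].
  exact: charge_integrable_cst.
have fab' x : A x -> `|f x| <= b * \1_Z x + a by rewrite addrC; exact: fab.
have /charge_integrableP[pf nf] := dominated_charge_integrable muA mf ig fab'.
have bound (m : {finite_measure set T -> \bar R}) : concentrated m A ->
    m.-integrable setT (EFin \o f) ->
    `|\int[m]_x f x| <= a * fine (m setT) + b * fine (m Z).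
  move=> mA fi; apply: le_trans (le_normr_Rintegral _ fi) _ => //.
  have <- : \int[m]_x (b * \1_Z x + a) = a * fine (m setT) + b * fine (m Z).
    rewrite Rintegral_comb//; last 2 first.
      exact: integrable_indic.
      exact: finite_measure_integrable_cst.
    rewrite Rintegral_cst// addrC; congr (_ + _ * _).
    by rewrite /Rintegral integral_indic// setIT.
  have mg : measurable_fun setT (fun x => b * \1_Z x + a).
    by apply: measurable_funD => //; exact: measurable_funM.
  apply: fine_le.
  - by apply: integrable_fin_num => //; exact: (integrable_norm fi).
  - apply: integrable_fin_num => //.
    apply: integrable_comb; first exact: integrable_indic.
    exact: finite_measure_integrable_cst.
  - apply: ae_ge0_le_integral => //.
    + by apply/measurable_EFinP; exact: measurableT_comp.
    + by move=> x _; rewrite lee_fin addr_ge0// mulr_ge0.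
    + exact/measurable_EFinP.
    + have := concentrated_ae mA
        (measurableT_comp (@normr_measurable R setT) mf) mg fab'.
      by apply: filterS => x h _; rewrite lee_fin; exact: h.
have vD B : measurable B -> fine (Defs.variation mu B) = fine (pos B) + fine (neg B).
  by move=> mB; rewrite -fineD//; exact: fin_num_measure.
rewrite /charge_integral (le_trans (ler_normB _ _))//.
rewrite /variation_norm !vD// !mulrDr addrACA lerD//; exact: bound.
Qed.

Lemma charge_integral_bounded A f a :
  supported mu A -> measurable_fun setT f -> 0 <= a ->
  (forall x, A x -> `|f x| <= a) ->
  charge_integrable mu f /\ `|charge_integral mu f| <= a * variation_norm mu.
Proof.
move=> muA mf a0 fa; split.
  exact: (dominated_charge_integrable muA mf (charge_integrable_cst a)).
have := @charge_integral_le A f set0 a 0 muA mf measurable0 a0 (lexx _).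
by rewrite mul0r addr0; apply=> x Ax; rewrite mul0r addr0 fa.
Qed.

End charge_integral_theory.

(** * Change of variables and iterated integrals *)

Section simple_charge_integral.
Context d {T : measurableType d} {R : realType}.
Variable mu : {charge set T -> \bar R}.

Lemma supportedT : supported mu setT.
Proof. by apply/supportedP => E _; rewrite setIT => ->; exact: charge0. Qed.

Lemma charge_integral_simple_cvg (f : T -> R) (s : nat -> T -> R) :
  charge_integrable mu f -> (forall n, simple_function (s n)) ->
  (forall n x, `|s n x| <= `|f x|) -> (forall x, s n x @[n --> \oo] --> f x) ->
  charge_integral mu (s n) @[n --> \oo] --> charge_integral mu f.
Proof.
move=> fi ss sf cs.
have [] // := @charge_dominated_convergence _ _ _ mu setT s f (normr \o f) supportedT.
- by move=> n; apply: ss; exact: simple_closed_measurable.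
- exact: integrable_norm fi.
Qed.

Lemma simple_charge_integrable (f : T -> R) : simple_function f -> charge_integrable mu f.
Proof.
apply; split=> [E mE|a g h _ _ gi hi]; first exact: charge_integrable_indic.
exact: charge_integrable_comb.
Qed.

End simple_charge_integral.

Section change_of_variables.
Context d d' {T : measurableType d} {T' : measurableType d'} {R : realType}.
Variables (mu : {charge set T -> \bar R}) (nu : {charge set T' -> \bar R}).

Lemma charge_integral_pushforward (phi : T -> T') (g : T' -> R) :
  measurable_fun setT phi ->
  (forall E, measurable E -> nu E = mu (phi @^-1` E)) ->
  charge_integrable nu g -> charge_integrable mu (g \o phi) ->
  charge_integral nu g = charge_integral mu (g \o phi).
Proof.
move=> mphi nuE gi gphii.
have mpre E : measurable E -> measurable (phi @^-1` E).
  by move=> mE; rewrite -[X in measurable X]setTI; exact: mphi.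
have mg := charge_integrable_measurable gi.
have [s [ss sg cs]] := simple_approximation mg.
pose P h := [/\ charge_integrable nu h, charge_integrable mu (h \o phi) &
  charge_integral nu h = charge_integral mu (h \o phi)].
have Ps n : P (s n).
  apply: ss; split=> [E mE|a u v mu' mv [u1 u2 u3] [v1 v2 v3]].
    have -> : P \1_E = [/\ charge_integrable nu \1_E,
        charge_integrable mu \1_(phi @^-1` E) &
        charge_integral nu \1_E = charge_integral mu \1_(phi @^-1` E)] by [].
    split; [exact: charge_integrable_indic| |].
      by apply: charge_integrable_indic; exact: mpre.
    by rewrite !charge_integral_indic ?nuE//; exact: mpre.
  split; [exact: charge_integrable_comb|exact: (charge_integrable_comb a u2 v2)|].
  rewrite charge_integral_comb// u3 v3.
  by rewrite -(charge_integral_comb a u2 v2).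
have c1 := charge_integral_simple_cvg gi ss sg cs.
have c2 : charge_integral nu (s n) @[n --> \oo] --> charge_integral mu (g \o phi).
  rewrite (_ : (fun n => _) = fun n => charge_integral mu (s n \o phi)); last first.
    by apply/funext => n; have [] := Ps n.
  have [] // := @charge_dominated_convergence _ _ _ mu setT (fun n => s n \o phi)
    (g \o phi) (normr \o g \o phi) (supportedT mu).
  - move=> n; apply: measurableT_comp => //.
    by apply: ss; exact: simple_closed_measurable.
  - exact: integrable_norm gphii.
  - by move=> n x _; exact: sg.
  - by move=> x; exact: cs.
exact: (cvg_unique _ c1 c2).
Qed.

End change_of_variables.

Section measures_with_bounded_support.
Context {R : realType} d (X : bornMeasType d).
Implicit Types (mu : M R X) (f : X -> R).

Definition locally_bounded f : Prop :=
  forall B, bornology B -> exists2 C, 0 <= C & forall x, B x -> `|f x| <= C.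

Lemma M_integrable mu f : measurable_fun setT f -> locally_bounded f ->
  charge_integrable mu f.
Proof.
move=> mf bf; have [B bB muB] := M_supported mu; have [C C0 fC] := bf _ bB.
by have [] := charge_integral_bounded muB mf C0 fC.
Qed.

(** For an indicator this is [Ev], measurable by the choice of the
    sigma-algebra; in general it is a pointwise limit of combinations of these. *)
Lemma measurable_charge_integral f : measurable_fun setT f -> locally_bounded f ->
  measurable_fun setT (fun mu : M R X => charge_integral mu f).
Proof.
move=> mf bf; have [s [ss sf cs]] := simple_approximation mf.
apply: (@measurable_fun_cvg _ _ _ _ (fun n (mu : M R X) => charge_integral mu (s n))).
  move=> n; suff [] : measurable_fun setT (fun mu : M R X => charge_integral mu (s n))
      /\ forall mu, charge_integrable mu (s n) by [].
  apply: (ss n (fun g => measurable_fun setT (fun mu : M R X => charge_integral mu g)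
      /\ forall mu, charge_integrable mu g)).
  split=> [E mE|a g h _ _ [mg gi] [mh hi]]; split.
  - rewrite (_ : (fun mu => _) = Ev E); first exact: measurable_Ev.
    by apply/funext => mu; rewrite charge_integral_indic.
  - by move=> mu; exact: charge_integrable_indic.
  - rewrite (_ : (fun mu => _) =
      fun mu : M R X => a * charge_integral mu g + charge_integral mu h).
      by apply: measurable_funD => //; exact: measurable_funM.
    by apply/funext => mu; rewrite charge_integral_comb.
  - by move=> mu; exact: charge_integrable_comb.
move=> mu _; apply: charge_integral_simple_cvg => //; exact: M_integrable.
Qed.

Lemma M_ball_integral_le (B : set X) (gamma : R) mu f C : M_ball B gamma mu ->
  measurable_fun setT f -> 0 <= C -> (forall x, B x -> `|f x| <= C) ->
  `|charge_integral mu f| <= C * gamma.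
Proof.
move=> [muB mug] mf C0 fC; have [_ le] := charge_integral_bounded muB mf C0 fC.
by rewrite (le_trans le)// ler_wpM2l.
Qed.

(** For indicators this is the definition of [kappa].  The passage to the limit
    inside the outer integral is dominated by a constant: a bound of [f] on the
    common bounded support, times a bound on the norms of the inner measures. *)
Lemma charge_integral_kappa (MM : M R (M R X)) f :
  measurable_fun setT f -> locally_bounded f ->
  charge_integrable MM (fun mu : M R X => charge_integral mu f) /\
  charge_integral (kappa MM) f =
  charge_integral MM (fun mu : M R X => charge_integral mu f).
Proof.
move=> mf bf; have [s [ss sf cs]] := simple_approximation mf.
have [B [gamma [bB sMM]]] := MM_supported MM.
have [C C0 fC] := bf _ bB.
pose I g := fun mu : M R X => charge_integral mu g.
pose P g := [/\ forall mu : M R X, charge_integrable mu g,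
  charge_integrable MM (I g) & charge_integral (kappa MM) g = charge_integral MM (I g)].
have Ps n : P (s n).
  apply: ss; split=> [E mE|a g h _ _ [g1 g2 g3] [h1 h2 h3]].
    have IE : I \1_E = Ev E by apply/funext => mu; rewrite /I charge_integral_indic.
    split.
    - by move=> mu; exact: charge_integrable_indic.
    - rewrite IE.
      (* If [gamma] is negative, the supporting ball is empty. *)
      have [g0|g0] := leP 0 gamma.
        have [] // := charge_integral_bounded sMM (measurable_Ev mE) g0.
        move=> mu muB; rewrite -[Ev E mu]/(fine (mu E)) -charge_integral_indic//.
        rewrite -[gamma]mul1r; apply: (M_ball_integral_le muB) => // x _.
        by rewrite indicE; case: (_ \in _); rewrite ?normr1 ?normr0.
      have [] // := charge_integral_bounded sMM (measurable_Ev mE) (lexx 0).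
      move=> mu [_ mug]; exfalso.
      by have := le_lt_trans (le_trans (variation_norm_ge0 mu) mug) g0; rewrite ltxx.
    - by rewrite charge_integral_indic// kappaE//= IE.
  have IE : I (fun x => a * g x + h x) = fun mu => a * I g mu + I h mu.
    by apply/funext => mu; rewrite /I charge_integral_comb.
  split.
  - by move=> mu; exact: charge_integrable_comb.
  - by rewrite IE; exact: charge_integrable_comb.
  - have ki u : (forall mu : M R X, charge_integrable mu u) ->
        charge_integrable (kappa MM) u by apply.
    by rewrite charge_integral_comb ?g3 ?h3 ?IE ?charge_integral_comb//; exact: ki.
have fi mu : charge_integrable mu f by exact: M_integrable.
have g0C : charge_integrable MM (fun=> C * gamma) := charge_integrable_cst _ _.
have [||||fI cI] := @charge_dominated_convergence _ _ _ MM (M_ball B gamma)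
   (fun n => I (s n)) (I f) (fun=> C * gamma) sMM.
- by move=> n; have [_ /charge_integrable_measurable] := Ps n.
- exact: g0C.
- move=> n mu muB; apply: (M_ball_integral_le muB) => //.
    by apply: ss; exact: simple_closed_measurable.
  by move=> x Bx; rewrite (le_trans (sf n x))// fC.
- by move=> mu; exact: charge_integral_simple_cvg.
split=> //.
have := charge_integral_simple_cvg (fi (kappa MM)) ss sf cs.
rewrite (_ : (fun n => _) = fun n => charge_integral MM (I (s n))); last first.
  by apply/funext => n; have [] := Ps n.
by move=> c; exact: (cvg_unique _ c cI).
Qed.

End measures_with_bounded_support.

(** * Existence of Pettis integrals *)

Section dual_representation.
Context {R : realType} (X : completeNormedModType R).

(** Evaluations at points are closed among functionals on the dual for uniform
    convergence on the unit ball: by Hahn-Banach the embedding of [X] into its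
    bidual is isometric, so its image is complete. *)
Lemma dual_approximation (L : dual_space X -> R) :
  (forall e, 0 < e -> exists y : X,
    forall phi, `|L phi - phi y| <= dual_norm phi * e) ->
  exists x : X, forall phi : dual_space X, phi x = L phi.
Proof.
move=> Ly.
have /choice[y yL] : forall n, exists y : X,
    forall phi, `|L phi - phi y| <= dual_norm phi * n.+1%:R^-1.
  by move=> n; exact: Ly.
have yy m n : `|y m - y n| <= m.+1%:R^-1 + n.+1%:R^-1.
  apply: dual_norm_bound => phi phi1; rewrite linearB/=.
  have -> : phi (y m) - phi (y n) = (L phi - phi (y n)) - (L phi - phi (y m)).
    by rewrite opprB [RHS]addrC addrA subrK.
  rewrite (le_trans (ler_norm _))// (le_trans (ler_normB _ _))// addrC.
  by rewrite lerD// (le_trans (yL _ _))// ler_piMl.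
have cy : cvgn y.
  apply/cauchy_cvgP/cauchyP => e e0.
  have [N _ NP] := near_infty_natSinv_lt (PosNum (divr_gt0 e0 (ltr0n R 2))).
  have {}NP n : (N <= n)%N -> n.+1%:R^-1 < e / 2 by move=> Nn; exact: NP n Nn.
  exists (y N); exists N => // n /= Nn; rewrite -ball_normE/=.
  by rewrite (le_lt_trans (yy _ _))// (splitr e) ltrD ?NP.
exists (limn y) => phi.
have c1 : (phi (y n) : R) @[n --> \oo] --> (phi (limn y) : R).
  have [C phiC] := dual_bounded phi.
  apply/cvgrPdist_le => e e0.
  have C1 : 0 < `|C| + 1 by rewrite ltr_wpDl.
  move/cvgrPdist_le : cy => /(_ (e / (`|C| + 1)) (divr_gt0 e0 C1)).
  apply: filterS => n h; rewrite -linearB/= (le_trans (phiC _))//.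
  rewrite (@le_trans _ _ ((`|C| + 1) * `|limn y - y n|))//.
    by rewrite ler_wpM2r// (le_trans (ler_norm C))// lerDl.
  by rewrite mulrC -ler_pdivlMr.
have c2 : (phi (y n) : R) @[n --> \oo] --> L phi.
  apply/cvgrPdist_le => e e0.
  have p1 : 0 < dual_norm phi + 1 by rewrite ltr_wpDl// dual_norm_ge0.
  have [N _ NP] := near_infty_natSinv_lt (PosNum (divr_gt0 e0 p1)).
  exists N => // n /= Nn; rewrite (le_trans (yL _ _))//.
  rewrite (@le_trans _ _ ((dual_norm phi + 1) * n.+1%:R^-1))//.
    by rewrite ler_wpM2r// lerDl.
  rewrite mulrC -ler_pdivlMr//; by apply/ltW; exact: NP n Nn.
exact: (cvg_unique _ c1 c2).
Qed.

End dual_representation.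

Section separable_spaces.
Context {R : realType} (X : normedModType R).

Definition dense_seq (u : nat -> X) : Prop :=
  forall x e, 0 < e -> exists n, `|x - u n| < e.

Lemma separable_dense_seq : Defs.separable X -> exists u : nat -> X, dense_seq u.
Proof.
move=> [D /pfcard_geP[D0|[u]] dD].
  have [x []] := dD setT (ex_intro _ 0 I) openT.
  by rewrite D0.
exists u => x e e0.
have [z [bz Dz]] := dD (ball x e) (ex_intro _ x (ballxx x e0)) (ball_open x e).
have [n _ uz] := 'surj_u Dz.
by exists n; rewrite uz; move: bz; rewrite -ball_normE.
Qed.

(** It suffices to norm the terms of a dense sequence, since [|x|] and
    [psi n x] both vary by at most [|x - u n|] when [x] is replaced by [u n]. *)
Lemma countable_norming (u : nat -> X) : dense_seq u ->
  exists psi : nat -> dual_space X,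
    forall x C, `|x| <= C <-> forall n, `|psi n x| <= C.
Proof.
move=> du; have [psi psiP] := choice (fun n => hahn_banach_norming (u n)).
exists psi => x C; split=> [xC n|xC].
  by have [+ _] := psiP n => /(_ x) /le_trans; exact.
apply/ler_addgt0Pr => e e0.
have [n un] := du x (e / 2) (divr_gt0 e0 (ltr0n R 2)).
have [psi1 psiu] := psiP n.
rewrite -(subrK (u n) x) (le_trans (ler_normD _ _))//.
have : psi n (u n) <= C + e / 2.
  rewrite -(subrK (x) (u n)) linearD/= addrC lerD//.
    exact: le_trans (ler_norm _) (xC n).
  by rewrite (le_trans (ler_norm _))// (le_trans (psi1 _))// distrC ltW.
rewrite psiu; move: un; set a := `|_|; set b := `|_|; lra.
Qed.

End separable_spaces.

Section pettis_existence.
Context {R : realType} (X : completeNormedModType R).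
Context d (T : measurableType d) (mu : {charge set T -> \bar R}).
Variables (f : T -> X) (A : set T) (C : R).
Hypotheses (mf : weakly_measurable f) (muA : supported mu A).
Hypotheses (C0 : 0 <= C) (fC : forall t, A t -> `|f t| <= C).

Lemma bounded_weak_integrable (phi : dual_space X) :
  charge_integrable mu (phi \o f) /\
  `|charge_integral mu (phi \o f)| <= dual_norm phi * C * variation_norm mu.
Proof.
have [] // := charge_integral_bounded (a := dual_norm phi * C) muA (mf phi).
  by rewrite mulr_ge0// dual_norm_ge0.
move=> t At; rewrite (le_trans (dual_normP _ _))// ler_wpM2l ?dual_norm_ge0//.
exact: fC.
Qed.

Lemma pettis_of_representative x :
  (forall phi : dual_space X, phi x = charge_integral mu (phi \o f)) ->
  pettis_integral mu f x.
Proof. by move=> xP phi; split=> //; have [] := bounded_weak_integrable phi. Qed.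

Lemma reflexive_pettis : reflexive_space X -> exists x, pettis_integral mu f x.
Proof.
move=> rX; pose L : dual_space X -> R^o := fun phi => charge_integral mu (phi \o f).
have LB : L \in bounded_functional (dual_space X).
  rewrite inE; split=> [a phi psi|].
    rewrite /L -[RHS]/(a * charge_integral mu (phi \o f) +
                       charge_integral mu (psi \o f)).
    rewrite -charge_integral_comb//; first by have [] := bounded_weak_integrable phi.
    by have [] := bounded_weak_integrable psi.
  exists (C * variation_norm mu) => phi; have [_] := bounded_weak_integrable phi.
  by rewrite -mulrA mulrC.
have : range (@to_bidual R X) (DualSpace LB) by rewrite rX.
move=> [x _ xL]; exists x; apply: pettis_of_representative => phi.
by rewrite -[LHS]/(to_bidual x phi) xL.
Qed.

(** The preimages [E n] of the balls of radius [e] around a dense sequence cover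
    the domain.  On the union [U N] of the first [N] of them, [f] is within [e]
    of a function with finitely many values; [N] is chosen so that the rest has
    variation at most [e], and on [A] the norm of [f] is at most [C] there. *)
Lemma separable_pettis : Defs.separable X -> exists x, pettis_integral mu f x.
Proof.
move=> /separable_dense_seq[u du].
have [psi psiP] := countable_norming du.
suff [x xP] : exists x : X, forall phi : dual_space X,
    phi x = charge_integral mu (phi \o f).
  by exists x; exact: pettis_of_representative.
apply: dual_approximation => e0 e00.
(* The total error is [|phi| * e * (norm mu + C)]; the 1 keeps [K] positive. *)
pose K := variation_norm mu + C + 1.
have K0 : 0 < K by rewrite ltr_wpDl// addr_ge0// charge_norm_ge0.
pose e := e0 / K; have e_gt0 : 0 < e by exact: divr_gt0.
have eK : e0 = e * K by rewrite /e divfK// gt_eqF.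
clearbody e.
pose E n := [set t | `|f t - u n| <= e].
have mE n : measurable (E n).
  have -> : E n = \bigcap_k [set t | `|psi k (f t) - psi k (u n)| <= e].
    apply/seteqP; split=> t /=.
      by move=> /psiP h k _ /=; rewrite -linearB; exact: h.
    by move=> h; apply/psiP => k; rewrite linearB; exact: h.
  apply: bigcapT_measurable => k.
  have mg : measurable_fun setT (fun t => `|psi k (f t) - psi k (u n)| : R).
    apply: measurableT_comp => //; apply: measurable_funB => //; exact: mf.
  have := mg measurableT `]-oo, e]%classic (measurable_itv _).
  by rewrite setTI; congr measurable; apply/seteqP; split=> t /=; rewrite in_itv.
pose U n := \big[setU/set0]_(k < n) E k.
have mU n : measurable (U n) by exact: bigsetU_measurable.
(* Each step gives the value [u n] to the points of [E n] not covered before. *)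
have simple n : exists (g : T -> X) y, [/\ pettis_integral mu g y,
    forall t, U n t -> `|f t - g t| <= e & forall t, ~ U n t -> g t = 0].
  elim: n => [|n [g [y [gy gU gU']]]].
    exists (fun=> 0), 0; split=> //; last by move=> t; rewrite /U big_ord0.
    move=> phi; rewrite (_ : phi \o _ = \1_set0); last first.
      by apply/funext => t /=; rewrite linear0 indicE in_set0.
    split; first exact: charge_integrable_indic.
    by rewrite charge_integral_indic// charge0 linear0.
  pose D := E n `\` U n.
  have mD : measurable D by exact: measurableD.
  exists (fun t => (\1_D t : R) *: u n + g t), (fine (mu D) *: u n + y); split.
  - move=> phi; have [gi gE] := gy phi.
    rewrite (_ : phi \o _ = fun t => phi (u n) * \1_D t + (phi \o g) t); last first.
      by apply/funext => t /=; rewrite linearD linearZ/= mulrC.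
    split; first by apply: charge_integrable_comb => //; exact: charge_integrable_indic.
    rewrite charge_integral_comb//; last exact: charge_integrable_indic.
    by rewrite charge_integral_indic// linearD linearZ/= mulrC gE.
  - move=> t; rewrite /U big_ord_recr/= => -[Ut|Et].
      by rewrite indicE memNset ?scale0r ?add0r; [exact: gU|case].
    have [Ut|nUt] := pselect (U n t).
      by rewrite indicE memNset ?scale0r ?add0r; [exact: gU|case].
    by rewrite indicE mem_set// scale1r gU'// addr0.
  - move=> t nU; have nUt : ~ U n t.
      by move=> Ut; apply: nU; rewrite /U big_ord_recr; left.
    rewrite gU'// addr0 indicE memNset ?scale0r// => -[Et _].
    by apply: nU; rewrite /U big_ord_recr; right.
have [N tail] : exists N, fine (Defs.variation mu (~` U N)) <= e.
  have := @nonincreasing_cvg_mu _ T R (Defs.variation mu) (fun n => ~` U n).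
  have -> : \bigcap_n ~` U n = set0.
    apply/seteqP; split=> // t h; have [n un] := du (f t) e e_gt0.
    apply: (h n.+1 I); rewrite /U big_ord_recr; right; exact: ltW.
  rewrite measure0 => c.
  have {c} /fine_cvgP[_ /cvgrPdist_le/(_ e e_gt0)[N _ NP]] :
      (Defs.variation mu \o (fun n => ~` U n)) x @[x --> \oo] --> 0%E.
    apply: c => //.
    - rewrite -[X in (X < _)%E]/(Defs.variation mu (~` U 0%N)) -variation_fin ?ltry//.
      exact: measurableC.
    - by move=> i; exact: measurableC.
    - move=> m n mn; apply/subsetPset/subsetC/subset_bigsetU.
      exact: mn.
  exists N; have := NP N (leqnn N); rewrite /= sub0r normrN.
  exact: le_trans (ler_norm _).
have [g [y [gy gU gU']]] := simple N; exists y => phi.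
have [fi _] := bounded_weak_integrable phi; have [gi gE] := gy phi.
rewrite gE.
have -> : charge_integral mu (phi \o f) - charge_integral mu (phi \o g) =
    charge_integral mu (fun t => -1 * (phi \o g) t + (phi \o f) t).
  by rewrite charge_integral_comb// mulN1r addrC.
have p0 := dual_norm_ge0 phi.
apply: (@le_trans _ _ (dual_norm phi * e * variation_norm mu +
    dual_norm phi * C * fine (Defs.variation mu (~` U N)))).
  apply: (charge_integral_le muA).
  - apply: measurable_funD; last exact: charge_integrable_measurable fi.
    by apply: measurable_funM => //; exact: charge_integrable_measurable gi.
  - exact: measurableC.
  - by rewrite mulr_ge0// ltW.
  - exact: mulr_ge0.
  - move=> t At; rewrite mulN1r addrC /= -linearB (le_trans (dual_normP _ _))//.
    rewrite -!mulrA -mulrDr ler_wpM2l//.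
    have [Ut|nUt] := pselect (U N t).
      by rewrite (le_trans (gU t Ut))// lerDl mulr_ge0.
    rewrite gU'// subr0 indicE mem_set// mulr1 (le_trans (fC At))// lerDr; exact: ltW.
rewrite -!mulrA -mulrDr ler_wpM2l// eK /K !mulrDr -addrA mulr1.
rewrite lerD2l (mulrC e).
rewrite (le_trans (ler_wpM2l C0 tail))// lerDl; exact: ltW.
Qed.

End pettis_existence.

(** * The barycenter algebra *)

Section weak_space.
Context {R : realType} (X : normedModType R).

Lemma measurable_dual (phi : dual_space X) :
  measurable_fun setT (phi : weak X -> R).
Proof. by move=> _ Y mY; apply: sub_gen_smallest; exists phi => //; exists Y. Qed.

Lemma measurable_weak d (T : measurableType d) (f : T -> weak X) :
  (forall phi : dual_space X, measurable_fun setT (fun t => phi (f t) : R)) ->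
  measurable_fun setT f.
Proof.
move=> mf.
apply: (@measurability _ _ T (weak X) setT f
  (\bigcup_(phi in [set: dual_space X])
     preimage_set_system setT (phi : weak X -> R) (@measurable _ R)) erefl).
move=> _ [_ [phi _ [Y mY <-]] <-]; rewrite !setTI.
by have := mf phi measurableT Y mY; rewrite setTI.
Qed.

Lemma bornology_normP (B : set (weak X)) :
  bornology B -> exists2 C, 0 <= C & forall x : X, B x -> `|x| <= C.
Proof. by move=> /pinfty_ex_gt0[C C0 BC]; exists C; [exact: ltW|exact: BC]. Qed.

Lemma norm_bornologyP (B : set (weak X)) C :
  (forall x : X, B x -> `|x| <= C) -> bornology B.
Proof.
move=> BC; have : \forall r \near +oo, C <= r by apply: nbhs_pinfty_ge; exact: num_real.
by apply: filterS => r Cr x /BC /le_trans; exact.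
Qed.

Lemma dual_locally_bounded (phi : dual_space X) :
  locally_bounded (phi : weak X -> R).
Proof.
move=> B /bornology_normP[C C0 BC]; exists (dual_norm phi * C).
  by rewrite mulr_ge0// dual_norm_ge0.
move=> x Bx; rewrite (le_trans (dual_normP _ _))// ler_wpM2l ?dual_norm_ge0//.
exact: BC.
Qed.

End weak_space.

Section pettis_spaces.
Context {R : realType} (X : completeNormedModType R).
Hypothesis HX : Defs.separable X \/ reflexive_space X.

Lemma pettis_exists d (T : measurableType d) (mu : {charge set T -> \bar R})
    (f : T -> X) (A : set T) C : weakly_measurable f -> supported mu A ->
  0 <= C -> (forall t, A t -> `|f t| <= C) -> exists x, pettis_integral mu f x.
Proof.
move=> mf muA C0 fC; have [sX|rX] := HX.
  exact: separable_pettis mf muA C0 fC sX.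
exact: reflexive_pettis mf muA C0 fC rX.
Qed.

Lemma separable_or_reflexive_enough_pettis : enough_pettis_integrals X.
Proof.
move=> d T f mf /pinfty_ex_gt0[C C0 fC] mu.
apply: (pettis_exists mf (supportedT mu) (ltW C0)) => t _.
by apply: fC; exists t.
Qed.

Lemma barycenter_exists (mu : M R (weak X)) :
  exists x : weak X, pettis_integral mu (fun x : weak X => x : X) x.
Proof.
have [B bB muB] := M_supported mu; have [C C0 BC] := bornology_normP bB.
by apply: (pettis_exists _ muB C0 BC); exact: measurable_dual.
Qed.

End pettis_spaces.

(** The Dirac measure is supported by the point [x], where [f] equals the
    constant [f x]. *)
Lemma charge_integral_delta {R : realType} d (X : bornMeasType d) (x : X)
    (f : X -> R) :
  measurable_fun setT f -> locally_bounded f -> charge_integral (delta R x) f = f x.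
Proof.
move=> mf bf; have fi := M_integrable (delta R x) mf bf.
have dx : supported (delta R x) [set x].
  apply/supportedP => E mE Ex; rewrite M_of_chargeE//=.
  rewrite /charge_of_finite_measure/= diracE memNset// => xE.
  by suff : (E `&` [set x]) x by rewrite Ex.
have c1 := charge_integrable_indic (delta R x) (@measurableT _ X).
have [||_] := @charge_integral_bounded _ _ _ (delta R x) [set x]
    (fun y => - f x * \1_setT y + f y) 0 dx _ (lexx 0).
- exact: (charge_integrable_measurable (charge_integrable_comb (- f x) c1 fi)).
- by move=> y ->; rewrite indicT mulr1 addNr normr0.
rewrite charge_integral_comb// charge_integral_indic//.
rewrite M_of_chargeE//= /charge_of_finite_measure/=.
rewrite indicE in_setT mulr1 mul0r.
by rewrite normr_le0 addrC subr_eq0 => /eqP.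
Qed.

Section pettis_algebra.
Context {R : realType} (X : normedModType R) (c : M R (weak X) -> weak X).
Hypothesis cP : forall mu : M R (weak X),
  pettis_integral mu (fun x : weak X => x : X) (c mu).

Lemma barycenterE (phi : dual_space X) mu :
  phi (c mu) = charge_integral mu (phi : weak X -> R).
Proof. by have [] := cP mu phi. Qed.

Lemma barycenter_measurable : measurable_fun setT c.
Proof.
apply: measurable_weak => phi.
rewrite (_ : (fun t => _) =
    fun mu : M R (weak X) => charge_integral mu (phi : weak X -> R)).
  apply: measurable_charge_integral; first exact: measurable_dual.
  exact: dual_locally_bounded.
by apply/funext => mu; rewrite barycenterE.
Qed.

Lemma barycenter_bornological S : bornology S -> bornology (c @` S).
Proof.
move=> [B [gamma [/bornology_normP[C C0 BC] g0 SB]]].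
apply: (@norm_bornologyP _ _ _ (C * gamma)) => _ [mu Smu <-].
apply: dual_norm_bound => phi phi1; rewrite barycenterE (le_trans (ler_norm _))//.
apply: (M_ball_integral_le (SB _ Smu)) => //; first exact: measurable_dual.
move=> x Bx; rewrite (le_trans (dual_normP _ _))//.
by rewrite (le_trans _ (BC x Bx))// ler_piMl.
Qed.

Definition barycenter_hom : bornMeasHom (M R (weak X)) (weak X) :=
  BornMeasHom barycenter_measurable barycenter_bornological.

Lemma barycenter_algebra : M_algebra barycenter_hom.
Proof.
split; apply/funext => MM; apply: dual_separates => phi /=; rewrite !barycenterE.
  rewrite charge_integral_delta//; first exact: measurable_dual.
  exact: dual_locally_bounded.
have mphi := measurable_dual phi; have bphi := dual_locally_bounded phi.
have [Ii ->] := charge_integral_kappa MM mphi bphi.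
have IE : (fun mu : M R (weak X) => charge_integral mu (phi : weak X -> R)) =
    (phi : weak X -> R) \o barycenter_hom.
  by apply/funext => mu /=; rewrite barycenterE.
rewrite IE in Ii *; apply: charge_integral_pushforward => //.
- exact: barycenter_measurable.
- by move=> E mE; rewrite M_of_chargeE.
- exact: M_integrable.
Qed.

End pettis_algebra.

Theorem corollary13p7 (R : realType) (X : completeNormedModType R) :
  separable X \/ reflexive_space X ->
  enough_pettis_integrals X /\
  exists c : bornMeasHom (M R (weak X)) (weak X),
    (forall mu : M R (weak X),
      pettis_integral mu (fun x : weak X => x : X) (c mu)) /\
    M_algebra c.
Proof.
move=> HX; split; first exact: separable_or_reflexive_enough_pettis.
have [c cP] := choice (barycenter_exists HX).
by exists (barycenter_hom cP); split=> //; exact: barycenter_algebra.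
Qed.
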